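(* Let $\mathbf C=(\mathbf C,\otimes)$ and $\mathbf D=(\mathbf D,\odot)$ be symmetric (strict) monoidal categories coclosed relative to full subcategories $\mathbf P\subset\mathbf C$ and $\mathbf Q\subset\mathbf D$ respectively. Let $F=(F,\varphi,\phi)\colon(\mathbf C,\otimes)\to(\mathbf D,\odot)$ be a colax monoidal functor such that $F(\mathbf P)\subset\mathbf Q$. Let $\mathbb O=(X,\Delta_X,\varepsilon_X)$ be a comonoid in $\mathbf C$ and let $\widetilde{\mathbb O}=\mathrm{Comon}(F)\mathbb O$ be the comonoid in $\mathbf D$ given by $FX$ with comultiplication $\phi_{X,X}\cdot F\Delta_X$ and counit $\varphi\cdot F\varepsilon_X$. Then $F$ induces a functor $$F^{\mathbb O}_{\mathbf P}\colon\mathrm{Corep}_{\mathbf P}(\mathbb O)\to\mathrm{Corep}_{\mathbf Q}(\widetilde{\mathbb O}),$$ which maps $(V,\omega)$ to $(FV,\widetilde\omega)$, where $\widetilde\omega$ is the composition $$\mathbf{coend}(FV)\xrightarrow{\Phi_{V,V}}F\big(\mathbf{coend}(V)\big)\xrightarrow{F\omega}FX,$$ and which maps a morphism $f\colon(V,\omega)\to(W,\nu)$ to the morphism $Ff\colon(FV,\widetilde\omega)\to(FW,\widetilde\nu)$, where $\widetilde\nu=F\nu\cdot\Phi_{W,W}$.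
   Context: Monoidal categories are strict; $f\cdot g$ denotes composition ($g$ first). A symmetric monoidal category $(\mathbf C,\otimes,I)$ is coclosed relative to a full subcategory $\mathbf P$ if there are a bifunctor $\mathbf{cohom}\colon\mathbf P^{op}\times\mathbf P\to\mathbf C$ and bijections $\vartheta_{W,V,Z}\colon\mathrm{Hom}(\mathbf{cohom}(V,W),Z)\to\mathrm{Hom}(W,Z\otimes V)$ natural in $V,W\in\mathbf P$, $Z\in\mathbf C$. Put $\mathrm{coev}_{V,W}=\vartheta(\mathrm{id})\colon W\to\mathbf{cohom}(V,W)\otimes V$. For $V\in\mathbf P$, $\mathbf{coend}(V)=\mathbf{cohom}(V,V)$ is a comonoid with comultiplication $d_V=\vartheta^{-1}\big((\mathrm{id}\otimes\mathrm{coev}_{V,V})\cdot\mathrm{coev}_{V,V}\big)$ and counit $v_V=\vartheta^{-1}(\mathrm{id}_V)$. The same notation is used in $\mathbf D$. $\mathrm{Corep}_{\mathbf P}(\mathbb O)$: objects are pairs $(V,\omega)$ with $V\in\mathbf P$ and $\omega\colon\mathbf{coend}(V)\to\mathbb O$ a morphism of comonoids; morphisms $(V,\omega)\to(W,\nu)$ are morphisms $f\colon V\to W$ in $\mathbf P$ with $\omega\cdot\mathbf{cohom}(f,\mathrm{id}_V)=\nu\cdot\mathbf{cohom}(\mathrm{id}_W,f)$ as morphisms $\mathbf{cohom}(W,V)\to X$. The colax structure is $\varphi\colon FI_{\mathbf C}\to I_{\mathbf D}$ and $\phi_{X,Y}\colon F(X\otimes Y)\to FX\odot FY$. For $V,W\in\mathbf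 P$, $\Phi_{V,W}=\vartheta^{-1}\big(\phi_{\mathbf{cohom}(V,W),V}\cdot F(\mathrm{coev}_{V,W})\big)\colon\mathbf{cohom}(FV,FW)\to F\big(\mathbf{cohom}(V,W)\big)$. *)

(* Defs.v *)
From mathcomp Require Import ssreflect ssrfun.
From mathcomp Require Import boolp.

Set Implicit Arguments.
Unset Strict Implicit.
Unset Printing Implicit Defensive.

Declare Scope cat_scope.
Delimit Scope cat_scope with cat.
Local Open Scope cat_scope.

Record category := Category {
  obj :> Type;
  hom : obj -> obj -> Type;
  idm : forall X, hom X X;
  cmp : forall X Y Z, hom Y Z -> hom X Y -> hom X Z;
  cmp1m : forall X Y (f : hom X Y), cmp (idm Y) f = f;
  cmpm1 : forall X Y (f : hom X Y), cmp f (idm X) = f;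
  cmpA : forall X Y Z T (h : hom Z T) (g : hom Y Z) (f : hom X Y),
    cmp h (cmp g f) = cmp (cmp h g) f }.

Arguments idm {c} X.

Notation "X ~> Y" := (hom X Y) (at level 99, Y at level 200) : cat_scope.
(* applicative order: g ⋅ f is "f, then g" *)
Notation "g ⋅ f" := (cmp g f) (at level 40, left associativity) : cat_scope.

Section Functors.
Variables C D : category.

Record is_functor (F0 : C -> D)
    (F1 : forall X Y : C, (X ~> Y) -> (F0 X ~> F0 Y)) : Prop := IsFunctor {
  is_functor1 : forall X, F1 X X (idm X) = idm (F0 X);
  is_functorM : forall X Y Z (g : Y ~> Z) (f : X ~> Y),
    F1 X Z (g ⋅ f) = F1 Y Z g ⋅ F1 X Y f }.

Record functor := Functor {
  fobj :> C -> D;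
  fmap : forall X Y : C, (X ~> Y) -> (fobj X ~> fobj Y);
  fmapP : is_functor fmap }.

Lemma fmap1 (F : functor) X : fmap F (idm X) = idm (F X).
Proof. exact: is_functor1 (fmapP F) X. Qed.

Lemma fmapM (F : functor) X Y Z (g : Y ~> Z) (f : X ~> Y) :
  fmap F (g ⋅ f) = fmap F g ⋅ fmap F f.
Proof. exact: is_functorM (fmapP F) _ _ _ g f. Qed.

End Functors.

Definition op_cat (C : category) : category :=
  @Category C (fun X Y => Y ~> X) (fun X => idm X) (fun _ _ _ g f => f ⋅ g)
    (fun _ _ f => cmpm1 f) (fun _ _ f => cmp1m f)
    (fun _ _ _ _ h g f => esym (cmpA f g h)).

Section Prod.
Variables C D : category.

Let phom (X Y : C * D) : Type := ((X.1 ~> Y.1) * (X.2 ~> Y.2))%type.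
Let pidm X : phom X X := (idm X.1, idm X.2).
Let pcmp X Y Z (g : phom Y Z) (f : phom X Y) : phom X Z :=
  (g.1 ⋅ f.1, g.2 ⋅ f.2).

Fact prod_cmp1m X Y (f : phom X Y) : pcmp (pidm Y) f = f.
Proof. by case: f => f1 f2; rewrite /pcmp !cmp1m. Qed.
Fact prod_cmpm1 X Y (f : phom X Y) : pcmp f (pidm X) = f.
Proof. by case: f => f1 f2; rewrite /pcmp !cmpm1. Qed.
Fact prod_cmpA X Y Z T (h : phom Z T) (g : phom Y Z) (f : phom X Y) :
  pcmp h (pcmp g f) = pcmp (pcmp h g) f.
Proof. by rewrite /pcmp /= !cmpA. Qed.

Definition prod_cat : category := Category prod_cmp1m prod_cmpm1 prod_cmpA.

End Prod.

Definition full_cat (C : category) (P : C -> Prop) : category :=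
  @Category {V : C | P V} (fun V W => sval V ~> sval W)
    (fun V => idm (sval V)) (fun _ _ _ g f => g ⋅ f)
    (fun _ _ f => cmp1m f) (fun _ _ f => cmpm1 f)
    (fun _ _ _ _ h g f => cmpA h g f).

(* The identity of X, seen as a morphism X ~> Y along an equality of objects.
   The equations of a strict monoidal category that are ill-typed because they
   compare morphisms between provably (not definitionally) equal objects are
   stated by inserting these morphisms. *)
Definition eqm (C : category) (X Y : C) (e : X = Y) : X ~> Y :=
  match e in _ = Z return X ~> Z with erefl => idm X end.

(* The pentagon and triangle are not fields: the associators and unitors being
   identities, they hold by proof irrelevance of equalities of objects. *)
Record strict_monoidal_category := StrictMonoidalCategory {
  mcat :> category;
  tensor : functor (prod_cat mcat mcat) mcat;
  unit_obj : mcat;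
  tensorA : forall X Y Z,
    tensor (tensor (X, Y), Z) = tensor (X, tensor (Y, Z));
  tensor1x : forall X, tensor (unit_obj, X) = X;
  tensorx1 : forall X, tensor (X, unit_obj) = X;
  tensorA_nat : forall X X' Y Y' Z Z'
      (f : X ~> X') (g : Y ~> Y') (h : Z ~> Z'),
    eqm (tensorA X' Y' Z') ⋅
      fmap tensor (X := (tensor (X, Y), Z)) (Y := (tensor (X', Y'), Z'))
        (fmap tensor (X := (X, Y)) (Y := (X', Y')) (f, g), h)
    = fmap tensor (X := (X, tensor (Y, Z))) (Y := (X', tensor (Y', Z')))
        (f, fmap tensor (X := (Y, Z)) (Y := (Y', Z')) (g, h))
      ⋅ eqm (tensorA X Y Z);
  tensor1x_nat : forall X Y (f : X ~> Y),
    eqm (tensor1x Y) ⋅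
      fmap tensor (X := (unit_obj, X)) (Y := (unit_obj, Y)) (idm unit_obj, f)
    = f ⋅ eqm (tensor1x X);
  tensorx1_nat : forall X Y (f : X ~> Y),
    eqm (tensorx1 Y) ⋅
      fmap tensor (X := (X, unit_obj)) (Y := (Y, unit_obj)) (f, idm unit_obj)
    = f ⋅ eqm (tensorx1 X) }.

Arguments unit_obj {s}.

Notation "X ⊗ Y" := (fobj (tensor _) (X, Y))
  (at level 38, left associativity) : cat_scope.

Section Tensor.
Variable M : strict_monoidal_category.
Implicit Types X Y Z : M.

Definition tensm X X' Y Y' (f : X ~> X') (g : Y ~> Y') : X ⊗ Y ~> X' ⊗ Y' :=
  fmap (tensor M) (X := (X, Y)) (Y := (X', Y')) (f, g).

Definition assoc X Y Z : (X ⊗ Y) ⊗ Z ~> X ⊗ (Y ⊗ Z) := eqm (tensorA X Y Z).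
Definition assocV X Y Z : X ⊗ (Y ⊗ Z) ~> (X ⊗ Y) ⊗ Z :=
  eqm (esym (tensorA X Y Z)).
Definition lunit X : unit_obj ⊗ X ~> X := eqm (tensor1x X).
Definition lunitV X : X ~> unit_obj ⊗ X := eqm (esym (tensor1x X)).
Definition runit X : X ⊗ unit_obj ~> X := eqm (tensorx1 X).

End Tensor.

Notation "f ⊗₁ g" := (tensm f g) (at level 38, left associativity) : cat_scope.

Record symmetric_monoidal_category := SymmetricMonoidalCategory {
  smcat :> strict_monoidal_category;
  braid : forall X Y : smcat, X ⊗ Y ~> Y ⊗ X;
  braid_nat : forall (X X' Y Y' : smcat) (f : X ~> X') (g : Y ~> Y'),
    braid X' Y' ⋅ (f ⊗₁ g) = (g ⊗₁ f) ⋅ braid X Y;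
  braidK : forall X Y : smcat, braid Y X ⋅ braid X Y = idm (X ⊗ Y);
  braid_hexagon : forall X Y Z : smcat,
    assoc Y Z X ⋅ braid X (Y ⊗ Z) ⋅ assoc X Y Z
    = (idm Y ⊗₁ braid X Z) ⋅ assoc Y X Z ⋅ (braid X Y ⊗₁ idm Z) }.

Record comonoid (M : strict_monoidal_category) := Comonoid {
  comon_obj :> M;
  comult : comon_obj ~> comon_obj ⊗ comon_obj;
  counit : comon_obj ~> unit_obj;
  comultA : assoc comon_obj comon_obj comon_obj
      ⋅ (comult ⊗₁ idm comon_obj) ⋅ comult
    = (idm comon_obj ⊗₁ comult) ⋅ comult;
  counitl : lunit comon_obj ⋅ (counit ⊗₁ idm comon_obj) ⋅ comult
    = idm comon_obj;
  counitr : runit comon_obj ⋅ (idm comon_obj ⊗₁ counit) ⋅ comult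
    = idm comon_obj }.

Definition is_comonoid_morphism (M : strict_monoidal_category)
    (A B : comonoid M) (f : A ~> B) : Prop :=
  comult B ⋅ f = (f ⊗₁ f) ⋅ comult A /\ counit B ⋅ f = counit A.

Arguments is_comonoid_morphism {M} A B f.

Section Eqm.
Variable C : category.

Lemma eqm_irr (X Y : C) (e e' : X = Y) : eqm e = eqm e'.
Proof. by rewrite (Prop_irrelevance e e'). Qed.

Lemma eqm_id (X : C) (e : X = X) : eqm e = idm X.
Proof. exact: (eqm_irr e erefl). Qed.

Lemma eqm_trans (X Y Z : C) (e : X = Y) (e' : Y = Z) :
  eqm e' ⋅ eqm e = eqm (etrans e e').
Proof. by case: Z / e'; rewrite /= cmp1m. Qed.

Lemma fmap_eqm (D : category) (F : functor C D) (X Y : C) (e : X = Y) :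
  fmap F (eqm e) = eqm (congr1 F e).
Proof. by case: Y / e; rewrite /= fmap1. Qed.

End Eqm.

Section Coherence.
Variable M : strict_monoidal_category.
Implicit Types X Y Z : M.

Lemma tensm1 X Y : idm X ⊗₁ idm Y = idm (X ⊗ Y).
Proof. exact: (fmap1 (tensor M) (X, Y)). Qed.

Lemma tensmM X X' X'' Y Y' Y'' (f' : X' ~> X'') (f : X ~> X')
    (g' : Y' ~> Y'') (g : Y ~> Y') :
  (f' ⊗₁ g') ⋅ (f ⊗₁ g) = (f' ⋅ f) ⊗₁ (g' ⋅ g).
Proof. by rewrite /tensm -fmapM. Qed.

Lemma tensm_idr X Y Z T (g : Y ~> Z) (f : X ~> Y) :
  (g ⋅ f) ⊗₁ idm T = (g ⊗₁ idm T) ⋅ (f ⊗₁ idm T).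
Proof. by rewrite tensmM cmpm1. Qed.

Lemma tensm_idl X Y Z T (g : Y ~> Z) (f : X ~> Y) :
  idm T ⊗₁ (g ⋅ f) = (idm T ⊗₁ g) ⋅ (idm T ⊗₁ f).
Proof. by rewrite tensmM cmpm1. Qed.

Lemma tensm_eqm X X' Y Y' (e : X = X') (e' : Y = Y') :
  eqm e ⊗₁ eqm e' = eqm (congr2 (fun A B => A ⊗ B) e e').
Proof. by case: X' / e; case: Y' / e'; rewrite tensm1 eqm_id. Qed.

Lemma assoc_nat X X' Y Y' Z Z' (f : X ~> X') (g : Y ~> Y') (h : Z ~> Z') :
  assoc X' Y' Z' ⋅ ((f ⊗₁ g) ⊗₁ h) = (f ⊗₁ (g ⊗₁ h)) ⋅ assoc X Y Z.
Proof. exact: tensorA_nat. Qed.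

Lemma assocK X Y Z : assocV X Y Z ⋅ assoc X Y Z = idm _.
Proof. by rewrite /assoc /assocV eqm_trans eqm_id. Qed.

Lemma assocVK X Y Z : assoc X Y Z ⋅ assocV X Y Z = idm _.
Proof. by rewrite /assoc /assocV eqm_trans eqm_id. Qed.

Lemma assocV_nat X X' Y Y' Z Z' (f : X ~> X') (g : Y ~> Y') (h : Z ~> Z') :
  ((f ⊗₁ g) ⊗₁ h) ⋅ assocV X Y Z = assocV X' Y' Z' ⋅ (f ⊗₁ (g ⊗₁ h)).
Proof.
by rewrite -[LHS]cmp1m -(assocK X' Y' Z') -!cmpA (cmpA (assoc _ _ _))
  assoc_nat -!cmpA assocVK cmpm1.
Qed.

Lemma lunit_nat X Y (f : X ~> Y) : lunit Y ⋅ (idm unit_obj ⊗₁ f) = f ⋅ lunit X.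
Proof. exact: tensor1x_nat. Qed.

Lemma runit_nat X Y (f : X ~> Y) : runit Y ⋅ (f ⊗₁ idm unit_obj) = f ⋅ runit X.
Proof. exact: tensorx1_nat. Qed.

Lemma lunitVK X : lunit X ⋅ lunitV X = idm X.
Proof. by rewrite /lunit /lunitV eqm_trans eqm_id. Qed.

Lemma lunitK X : lunitV X ⋅ lunit X = idm _.
Proof. by rewrite /lunit /lunitV eqm_trans eqm_id. Qed.

Lemma lunitV_nat X Y (f : X ~> Y) :
  (idm unit_obj ⊗₁ f) ⋅ lunitV X = lunitV Y ⋅ f.
Proof.
by rewrite -[LHS]cmp1m -(lunitK Y) -!cmpA (cmpA (lunit _)) lunit_nat -!cmpA
  lunitVK cmpm1.
Qed.

End Coherence.

Record coclosed (C : symmetric_monoidal_category) (P : C -> Prop) := Coclosed {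
  cohom_functor :
    functor (prod_cat (op_cat (full_cat P)) (full_cat P)) C;
  theta : forall (V W : full_cat P) (Z : C),
    (cohom_functor (V, W) ~> Z) -> (sval W ~> Z ⊗ sval V);
  thetaV : forall (V W : full_cat P) (Z : C),
    (sval W ~> Z ⊗ sval V) -> (cohom_functor (V, W) ~> Z);
  thetaK : forall V W Z, cancel (@theta V W Z) (@thetaV V W Z);
  thetaVK : forall V W Z, cancel (@thetaV V W Z) (@theta V W Z);
  theta_nat : forall (V V' W W' : full_cat P) (Z Z' : C)
      (v : V ~> V') (w : W' ~> W) (h : Z ~> Z')
      (k : cohom_functor (V, W) ~> Z),
    theta (h ⋅ k ⋅ fmap cohom_functor (X := (V', W')) (Y := (V, W)) (v, w))
    = (h ⊗₁ (v : sval V ~> sval V')) ⋅ theta k ⋅ w }.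

Arguments theta {C P c V W Z} _.
Arguments thetaV {C P c V W Z} _.

Section Coend.
Variables (C : symmetric_monoidal_category) (P : C -> Prop) (H : coclosed P).
Implicit Types V W : full_cat P.

Definition cohom V W : C := cohom_functor H (V, W).

(* contravariant in the first variable *)
Definition cohomm V V' W W' (v : V ~> V') (w : W ~> W') :
    cohom V' W ~> cohom V W' :=
  fmap (cohom_functor H) (X := (V', W)) (Y := (V, W')) (v, w).

Definition coev V W : sval W ~> cohom V W ⊗ sval V := theta (idm (cohom V W)).

Definition coend_comult V : cohom V V ~> cohom V V ⊗ cohom V V :=
  thetaV (assocV (cohom V V) (cohom V V) (sval V)
          ⋅ (idm (cohom V V) ⊗₁ coev V V) ⋅ coev V V).

Definition coend_counit V : cohom V V ~> unit_obj :=
  thetaV (lunitV (sval V) : sval V ~> unit_obj ⊗ sval V).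

Lemma cohomm1 V W : cohomm (idm V) (idm W) = idm (cohom V W).
Proof. exact: (fmap1 (cohom_functor H) (V, W)). Qed.

Lemma cohommM V V' V'' W W' W'' (v' : V' ~> V'') (v : V ~> V')
    (w' : W' ~> W'') (w : W ~> W') :
  cohomm v w' ⋅ cohomm v' w = cohomm (v' ⋅ v) (w' ⋅ w).
Proof. by rewrite /cohomm -fmapM. Qed.

Lemma thetaE V W (Z : C) (k : cohom V W ~> Z) :
  theta k = (k ⊗₁ idm (sval V)) ⋅ coev V W.
Proof.
have := theta_nat (idm V) (idm W) k (idm (cohom V W)).
by rewrite [fmap _ _]cohomm1 !cmpm1 => ->.
Qed.

Lemma theta_inj V W (Z : C) (k k' : cohom V W ~> Z) :
  (k ⊗₁ idm (sval V)) ⋅ coev V W = (k' ⊗₁ idm (sval V)) ⋅ coev V W -> k = k'.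
Proof. by rewrite -!thetaE => /(can_inj (@thetaK _ _ H V W Z)). Qed.

Lemma coend_comultE V :
  (coend_comult V ⊗₁ idm (sval V)) ⋅ coev V V
  = assocV (cohom V V) (cohom V V) (sval V)
    ⋅ (idm (cohom V V) ⊗₁ coev V V) ⋅ coev V V.
Proof. by rewrite -thetaE thetaVK. Qed.

Lemma coend_counitE V :
  (coend_counit V ⊗₁ idm (sval V)) ⋅ coev V V = lunitV (sval V).
Proof. by rewrite -thetaE thetaVK. Qed.

Fact coend_comultA V (E := cohom V V) :
  assoc E E E ⋅ (coend_comult V ⊗₁ idm E) ⋅ coend_comult V
  = (idm E ⊗₁ coend_comult V) ⋅ coend_comult V.
Proof.
apply: theta_inj; rewrite !tensm_idr -!cmpA !coend_comultE -!cmpA.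
rewrite !(cmpA _ (assocV _ _ _)) !assocV_nat tensm1 -!cmpA.
rewrite !(cmpA _ (_ ⊗₁ coev V V)) !tensmM !cmp1m !cmpm1 coend_comultE.
rewrite -{1}[coend_comult V]cmp1m -{1}[coev V V]cmpm1 -tensmM -!cmpA.
rewrite coend_comultE.
rewrite !tensm_idl.
rewrite !cmpA; congr (_ ⋅ _ ⋅ _).
rewrite -tensm1 -!cmpA (cmpA _ (assocV _ _ _)) assocV_nat !cmpA.
congr (_ ⋅ _).
by rewrite /assoc /assocV -?[idm _]/(eqm erefl) !tensm_eqm !eqm_trans;
  apply: eqm_irr.
Qed.

Fact coend_counitl V (E := cohom V V) :
  lunit E ⋅ (coend_counit V ⊗₁ idm E) ⋅ coend_comult V = idm E.
Proof.
apply: theta_inj; rewrite !tensm_idr -!cmpA coend_comultE -!cmpA.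
rewrite (cmpA _ (assocV _ _ _)) assocV_nat tensm1 -!cmpA.
rewrite (cmpA _ (_ ⊗₁ coev V V)) tensmM cmp1m cmpm1.
rewrite -{1}[coend_counit V]cmp1m -{1}[coev V V]cmpm1 -tensmM -!cmpA.
rewrite coend_counitE lunitV_nat !cmpA -[RHS]cmp1m; congr (_ ⋅ _).
by rewrite /assocV /lunit /lunitV -?[idm _]/(eqm erefl) !tensm_eqm !eqm_trans;
  apply: eqm_irr.
Qed.

Fact coend_counitr V (E := cohom V V) :
  runit E ⋅ (idm E ⊗₁ coend_counit V) ⋅ coend_comult V = idm E.
Proof.
apply: theta_inj; rewrite !tensm_idr -!cmpA coend_comultE -!cmpA.
rewrite (cmpA _ (assocV _ _ _)) assocV_nat -!cmpA.
rewrite (cmpA _ (_ ⊗₁ coev V V)) tensmM cmp1m coend_counitE.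
rewrite !cmpA tensm1 !cmp1m -[RHS]cmp1m; congr (_ ⋅ _).
by rewrite /assocV /runit /lunitV -?[idm _]/(eqm erefl) !tensm_eqm !eqm_trans;
  apply: eqm_irr.
Qed.

Definition coend V : comonoid C :=
  Comonoid (coend_comultA V) (coend_counitl V) (coend_counitr V).

End Coend.

Record colax_functor (C D : strict_monoidal_category) := ColaxFunctor {
  colax_fun :> functor C D;
  colax0 : colax_fun unit_obj ~> unit_obj;
  colax2 : forall X Y : C, colax_fun (X ⊗ Y) ~> colax_fun X ⊗ colax_fun Y;
  colax2_nat : forall (X X' Y Y' : C) (f : X ~> X') (g : Y ~> Y'),
    colax2 X' Y' ⋅ fmap colax_fun (f ⊗₁ g)
    = (fmap colax_fun f ⊗₁ fmap colax_fun g) ⋅ colax2 X Y;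
  colaxA : forall X Y Z : C,
    assoc (colax_fun X) (colax_fun Y) (colax_fun Z)
      ⋅ (colax2 X Y ⊗₁ idm (colax_fun Z)) ⋅ colax2 (X ⊗ Y) Z
    = (idm (colax_fun X) ⊗₁ colax2 Y Z) ⋅ colax2 X (Y ⊗ Z)
      ⋅ fmap colax_fun (assoc X Y Z);
  colax_unitl : forall X : C,
    lunit (colax_fun X) ⋅ (colax0 ⊗₁ idm (colax_fun X)) ⋅ colax2 unit_obj X
    = fmap colax_fun (lunit X);
  colax_unitr : forall X : C,
    runit (colax_fun X) ⋅ (idm (colax_fun X) ⊗₁ colax0) ⋅ colax2 X unit_obj
    = fmap colax_fun (runit X) }.

Section ComonMap.
Variables (C D : strict_monoidal_category) (F : colax_functor C D).
Variable O : comonoid C.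

Let mult : F O ~> F O ⊗ F O := colax2 F O O ⋅ fmap F (comult O).
Let cou : F O ~> unit_obj := colax0 F ⋅ fmap F (counit O).

Fact comon_mapA :
  assoc (F O) (F O) (F O) ⋅ (mult ⊗₁ idm (F O)) ⋅ mult
  = (idm (F O) ⊗₁ mult) ⋅ mult.
Proof.
rewrite /mult tensm_idr tensm_idl -!cmpA.
rewrite !(cmpA _ (colax2 F O O)) -!(fmap1 F) -!colax2_nat -!cmpA -!fmapM.
rewrite -comultA !fmapM ?fmap1 !cmpA -colaxA; do 2 congr (_ ⋅ _).
Qed.

Fact comon_mapl : lunit (F O) ⋅ (cou ⊗₁ idm (F O)) ⋅ mult = idm (F O).
Proof.
rewrite /mult /cou tensm_idr -!cmpA (cmpA _ (colax2 F O O)).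
rewrite -!(fmap1 F) -colax2_nat -[RHS]/(fmap F (idm O)) -[in RHS](counitl O).
by rewrite !fmapM -colax_unitl ?fmap1 !cmpA.
Qed.

Fact comon_mapr : runit (F O) ⋅ (idm (F O) ⊗₁ cou) ⋅ mult = idm (F O).
Proof.
rewrite /mult /cou tensm_idl -!cmpA (cmpA _ (colax2 F O O)).
rewrite -!(fmap1 F) -colax2_nat -[RHS]/(fmap F (idm O)) -[in RHS](counitr O).
by rewrite !fmapM -colax_unitr ?fmap1 !cmpA.
Qed.

Definition comon_map : comonoid D := Comonoid comon_mapA comon_mapl comon_mapr.

End ComonMap.

Section Corep.
Variables (C : symmetric_monoidal_category) (P : C -> Prop) (H : coclosed P).
Variable O : comonoid C.

Record corep_obj := CorepObj {
  corep_carrier : full_cat P;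
  corep_mor : coend H corep_carrier ~> O;
  corep_morP : is_comonoid_morphism (coend H corep_carrier) O corep_mor }.

Definition is_corep_morphism (A B : corep_obj)
    (f : corep_carrier A ~> corep_carrier B) : Prop :=
  corep_mor A ⋅ cohomm H f (idm (corep_carrier A))
  = corep_mor B ⋅ cohomm H (idm (corep_carrier B)) f.

Let chom (A B : corep_obj) : Type :=
  {f : corep_carrier A ~> corep_carrier B | is_corep_morphism f}.

Fact corep_idP (A : corep_obj) :
  @is_corep_morphism A A (idm (corep_carrier A)).
Proof. by []. Qed.

Fact corep_cmpP (A B E : corep_obj) (g : chom B E) (f : chom A B) :
  @is_corep_morphism A E (sval g ⋅ sval f).
Proof.
case: g f => [g gP] [f fP] /=; rewrite /is_corep_morphism.
have -> : cohomm H (g ⋅ f) (idm (corep_carrier A))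
    = cohomm H f (idm (corep_carrier A))
      ⋅ cohomm H g (idm (corep_carrier A)) by rewrite cohommM cmp1m.
have -> : cohomm H (idm (corep_carrier E)) (g ⋅ f)
    = cohomm H (idm (corep_carrier E)) g
      ⋅ cohomm H (idm (corep_carrier E)) f by rewrite cohommM cmp1m.
rewrite !cmpA [in LHS]fP -[in RHS]gP -!cmpA !cohommM.
by rewrite !cmp1m !cmpm1.
Qed.

Let cid (A : corep_obj) : chom A A := exist _ _ (corep_idP A).
Let ccmp (A B E : corep_obj) (g : chom B E) (f : chom A B) : chom A E :=
  exist _ _ (corep_cmpP g f).

Fact corep_cmp1m A B (f : chom A B) : ccmp (cid B) f = f.
Proof. by case: f => f fP; apply: eq_exist; exact: cmp1m. Qed.
Fact corep_cmpm1 A B (f : chom A B) : ccmp f (cid A) = f.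
Proof. by case: f => f fP; apply: eq_exist; exact: cmpm1. Qed.
Fact corep_cmpA A B E G (h : chom E G) (g : chom B E) (f : chom A B) :
  ccmp h (ccmp g f) = ccmp (ccmp h g) f.
Proof. by apply: eq_exist; exact: cmpA. Qed.

Definition corep : category := Category corep_cmp1m corep_cmpm1 corep_cmpA.

End Corep.

Section Induced.
Variables (C D : symmetric_monoidal_category).
Variables (P : C -> Prop) (Q : D -> Prop).
Variables (HC : coclosed P) (HD : coclosed Q).
Variables (F : colax_functor C D) (FPQ : forall V, P V -> Q (F V)).

Definition full_map (V : full_cat P) : full_cat Q :=
  exist Q (F (sval V)) (FPQ (svalP V)).

Definition Phi (V W : full_cat P) :
    cohom HD (full_map V) (full_map W) ~> F (cohom HC V W) :=
  thetaV (V := full_map V) (W := full_map W)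
    (colax2 F (cohom HC V W) (sval V) ⋅ fmap F (coev HC V W)).

Definition induced_mor (O : comonoid C) (A : corep HC O) :
    coend HD (full_map (corep_carrier A)) ~> comon_map F O :=
  fmap F (corep_mor A) ⋅ Phi (corep_carrier A) (corep_carrier A).

End Induced.

(* Main.v *)
Require Import Defs.
From mathcomp Require Import ssreflect ssrfun.
From mathcomp Require Import boolp.

(** A morphism out of [cohom V W] is determined by its composite with the
    coevaluation, so the identities between such morphisms are checked
    after tensoring with the identity of the first argument and composing with
    [coev].  The morphism [Phi V W] is characterised in this way by [Phi_coev]: it carries the
    coevaluation of the images to the image of the coevaluation followed by
    the colax constraint.

    From this characterisation, the naturality of the colax constraint makes
    [Phi] natural in both arguments ([Phi_nat]), and the coherence axioms of
    the colax functor make [Phi V V] a morphism of comonoids from the coend of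
    the image of [V] to the image of the coend of [V] ([Phi_comonoid]).
    Composing the latter with the image of the comonoid morphism attached to a
    corepresentation gives a corepresentation of the image comonoid, and
    [Phi_nat] carries the equation defining morphisms of corepresentations
    through the colax functor ([induced_corep_morphism]).  Functoriality is
    inherited from that of the underlying functor, since a morphism of
    corepresentations is determined by its underlying morphism. *)

Set Implicit Arguments.
Unset Strict Implicit.
Unset Printing Implicit Defensive.

Local Open Scope cat_scope.

Lemma tensm_swap (M : strict_monoidal_category) (X X' Y Y' : M)
    (f : X ~> X') (g : Y ~> Y') :
  (f ⊗₁ idm Y') ⋅ (idm X ⊗₁ g) = (idm X' ⊗₁ g) ⋅ (f ⊗₁ idm Y).
Proof. by rewrite !tensmM !cmp1m !cmpm1. Qed.

Lemma comonoid_morphism_comp (M : strict_monoidal_category)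
    (A B E : comonoid M) (g : B ~> E) (f : A ~> B) :
  is_comonoid_morphism B E g -> is_comonoid_morphism A B f ->
  is_comonoid_morphism A E (g ⋅ f).
Proof.
move=> [gM gU] [fM fU]; split; last by rewrite cmpA gU.
by rewrite cmpA gM -cmpA fM cmpA tensmM.
Qed.

(** The action of [comon_map F] on morphisms. *)
Lemma comon_map_morphism (C D : strict_monoidal_category)
    (F : colax_functor C D) (A B : comonoid C) (f : A ~> B) :
  is_comonoid_morphism A B f ->
  is_comonoid_morphism (comon_map F A) (comon_map F B) (fmap F f).
Proof.
move=> [fM fU]; split; rewrite /= -cmpA -fmapM; last by rewrite fU.
by rewrite fM fmapM !cmpA colax2_nat.
Qed.

(** The coevaluation is natural in its second argument and dinatural in its
    first one. *)
Lemma coev_nat (C : symmetric_monoidal_category) (P : C -> Prop)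
    (H : coclosed P) (V V' W W' : full_cat P) (v : V ~> V') (w : W ~> W') :
  (cohomm H v w ⊗₁ idm (sval V')) ⋅ coev H V' W
  = (idm (cohom H V W') ⊗₁ (v : sval V ~> sval V')) ⋅ coev H V W' ⋅ w.
Proof.
have := theta_nat v w (idm (cohom H V W')) (idm (cohom H V W')).
by rewrite !cmp1m -/(cohomm H v w) thetaE => ->.
Qed.

(** The associativity constraint of a colax functor, for the inverse
    associators. *)
Lemma colaxAV (C D : strict_monoidal_category) (F : colax_functor C D)
    (X Y Z : C) :
  (colax2 F X Y ⊗₁ idm (F Z)) ⋅ colax2 F (X ⊗ Y) Z ⋅ fmap F (assocV X Y Z)
  = assocV (F X) (F Y) (F Z) ⋅ (idm (F X) ⊗₁ colax2 F Y Z)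
    ⋅ colax2 F X (Y ⊗ Z).
Proof.
rewrite -[LHS]cmp1m -(assocK (F X) (F Y) (F Z)) -!cmpA.
congr (_ ⋅ _); rewrite !cmpA colaxA -!cmpA -fmapM assocVK fmap1.
by rewrite cmpm1.
Qed.

Lemma colax_unitlV (C D : strict_monoidal_category) (F : colax_functor C D)
    (X : C) :
  (colax0 F ⊗₁ idm (F X)) ⋅ colax2 F unit_obj X ⋅ fmap F (lunitV X)
  = lunitV (F X).
Proof.
rewrite -[LHS]cmp1m -(lunitK (F X)) -!cmpA -[RHS]cmpm1.
by congr (_ ⋅ _); rewrite !cmpA colax_unitl -fmapM lunitVK fmap1.
Qed.

Section InducedFunctor.
Variables (C D : symmetric_monoidal_category).
Variables (P : C -> Prop) (Q : D -> Prop).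
Variables (HC : coclosed P) (HD : coclosed Q).
Variables (F : colax_functor C D) (FPQ : forall V, P V -> Q (F V)).

Local Notation FV := (full_map FPQ).
Local Notation PhiF := (Phi HC HD FPQ).

(** The defining property of [Phi]. *)
Lemma Phi_coev (V W : full_cat P) :
  (PhiF V W ⊗₁ idm (F (sval V))) ⋅ coev HD (FV V) (FV W)
  = colax2 F (cohom HC V W) (sval V) ⋅ fmap F (coev HC V W).
Proof. by rewrite -(thetaE (V := FV V) (W := FV W)) thetaVK. Qed.

(** [Phi_coev] in the form used for a morphism [fmap F k ⋅ Phi V W]: the
    composite with the coevaluation is the colax constraint after the image of
    [theta k]. *)
Lemma fmap_Phi_coev (V W : full_cat P) (Z : C) (k : cohom HC V W ~> Z) :
  ((fmap F k ⋅ PhiF V W) ⊗₁ idm (F (sval V))) ⋅ coev HD (FV V) (FV W)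
  = colax2 F Z (sval V) ⋅ fmap F ((k ⊗₁ idm (sval V)) ⋅ coev HC V W).
Proof.
by rewrite tensm_idr -cmpA Phi_coev fmapM !cmpA colax2_nat fmap1.
Qed.

Lemma Phi_nat (V V' W W' : full_cat P) (v : V ~> V') (w : W ~> W') :
  PhiF V W' ⋅ cohomm HD (V := FV V) (V' := FV V') (W := FV W) (W' := FV W')
      (fmap F (v : sval V ~> sval V')) (fmap F (w : sval W ~> sval W'))
  = fmap F (cohomm HC v w) ⋅ PhiF V' W.
Proof.
apply: theta_inj; rewrite [RHS]fmap_Phi_coev coev_nat tensm_idr -cmpA coev_nat.
rewrite !cmpA tensm_swap -(cmpA _ (_ ⊗₁ _) (coev _ _ _)) Phi_coev.
by rewrite !fmapM !cmpA colax2_nat fmap1.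
Qed.

Lemma Phi_comonoid (V : full_cat P) :
  is_comonoid_morphism (coend HD (FV V)) (comon_map F (coend HC V)) (PhiF V V).
Proof.
split; apply: theta_inj; rewrite /= -[in LHS]cmpA.
- rewrite [in LHS]tensm_idr -[LHS]cmpA fmap_Phi_coev coend_comultE.
  rewrite !fmapM !cmpA colaxAV tensm_idr -!cmpA.
  have /= -> := coend_comultE HD (FV V); rewrite -!cmpA.
  rewrite [in RHS](cmpA _ (assocV _ _ _)) assocV_nat -!cmpA; congr (_ ⋅ _).
  rewrite [in LHS](cmpA _ _ (fmap F (coev _ _ _))) colax2_nat fmap1.
  (* Phi_coev rewritten backwards makes the outer coevaluation that of the
     images, as on the right; the inner one is then rewritten forwards *)
  rewrite -!cmpA -Phi_coev !cmpA !tensmM Phi_coev.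
  by rewrite !cmp1m !cmpm1.
- rewrite [in LHS]tensm_idr -[LHS]cmpA fmap_Phi_coev coend_counitE.
  by rewrite cmpA colax_unitlV; exact/esym/(coend_counitE HD (FV V)).
Qed.

Variable O : comonoid C.

Lemma induced_mor_comonoid (A : corep HC O) :
  is_comonoid_morphism (coend HD (FV (corep_carrier A))) (comon_map F O)
    (induced_mor HD FPQ A).
Proof.
apply: (comonoid_morphism_comp (B := comon_map F (coend HC (corep_carrier A)))).
  exact/comon_map_morphism/corep_morP.
exact: Phi_comonoid.
Qed.

(** The corepresentation of the image comonoid induced by a corepresentation. *)
Definition induced_corep (A : corep HC O) : corep HD (comon_map F O) :=
  CorepObj (induced_mor_comonoid A).

Lemma induced_corep_morphism (A B : corep HC O)
    (f : corep_carrier A ~> corep_carrier B) :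
  is_corep_morphism f ->
  is_corep_morphism (A := induced_corep A) (B := induced_corep B)
    (fmap F (f : sval _ ~> sval _)).
Proof.
move=> fP; rewrite /is_corep_morphism /= /induced_mor -!cmpA.
have := Phi_nat f (idm (corep_carrier A)).
have := Phi_nat (idm (corep_carrier B)) f.
rewrite !fmap1 /= => -> ->.
by rewrite !cmpA -!fmapM fP.
Qed.

End InducedFunctor.

Theorem theorem3p28 (C D : symmetric_monoidal_category)
    (P : C -> Prop) (Q : D -> Prop) (HC : coclosed P) (HD : coclosed Q)
    (F : colax_functor C D) (FPQ : forall V : C, P V -> Q (F V))
    (O : comonoid C) :
  exists induced_morP : forall A : corep HC O,
      is_comonoid_morphism (coend HD (full_map FPQ (corep_carrier A)))
        (comon_map F O) (induced_mor HD FPQ A),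
  let Fob (A : corep HC O) : corep HD (comon_map F O) :=
    CorepObj (induced_morP A) in
  exists Fmor : forall A B : corep HC O, (A ~> B) -> (Fob A ~> Fob B),
    (forall (A B : corep HC O) (f : A ~> B),
        sval (Fmor A B f) = fmap F (sval f))
    /\ is_functor Fmor.
Proof.
exists (@induced_mor_comonoid C D P Q HC HD F FPQ O) => Fob.
exists (fun A B f => exist _ _ (induced_corep_morphism HD FPQ (svalP f))).
split=> //; split=> [A|A B E g f]; apply: eq_exist; rewrite /=.
- exact: fmap1.
- exact: fmapM.
Qed.
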